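(* Let $k,l,m$ be positive integers, $n=(l+1)k$, and let $A\in\mathbb{R}^{m\times n}$ have $2k$-restricted isometry constant $\delta_{2k}\in[\frac{\sqrt{2}}{2},1)$. Let $x\in\mathbb{R}^n$, $\epsilon\ge 0$, $e\in\mathbb{R}^m$ with $\|e\|_2\le\epsilon$, and $y=Ax+e$. For $p\in(0,1)$ let $x^{\star}$ be a solution of $\min_{\gamma\in\mathbb{R}^n}\|\gamma\|_p$ subject to $\|y-A\gamma\|_2\le\epsilon$, and let $T_0^c=\{k+1,\dots,n\}$. Define $$C(p)=\begin{cases}\left(\dfrac{\big((2-\delta_{2k})^{1-\frac{2}{p}}+2\delta_{2k}\big)g(p)}{1-\delta_{2k}}\right)^{p/2}, & p\in(0,p^{\star}],\\[2ex] \left(\dfrac{(2-\delta_{2k})^{1-\frac{2}{p}}g(p)+2^{2-\frac{2}{p}}\delta_{2k}}{1-\delta_{2k}}\right)^{p/2}, & p\in(p^{\star},1),\end{cases}\qquad D(p)=\begin{cases}\left(\dfrac{(2+\delta_{2k})g(p)}{1-\delta_{2k}}\right)^{p/2}, & p\in(0,p^{\star}],\\[2ex] \left(\dfrac{(2-\delta_{2k})g(p)+2^{2-\frac{2}{p}}\delta_{2k}}{1-\delta_{2k}}\right)^{p/2}, & p\in(p^{\star},1).\end{cases}$$ Then for each $p\in(0,1)$ with $C(p)<1$, $$\|x-x^{\star}\|_2^p\le D_0k^{\frac{p}{2}-1}\|x_{T_0^c}\|_p^p+D_1\epsilon^p,\qquad D_0=\frac{2D(p)}{1-C(p)},\quad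 D_1=\frac{1}{(1-\delta_{2k})^{\frac p2}}\Big(2^p+\frac{2^{\frac{3p}{2}}D(p)}{1-C(p)}\Big).$$ In particular, if $\epsilon=0$ and $x$ is $k$-sparse, then $x^{\star}=x$.
   Context: For $1\le s\le n$, the $s$-restricted isometry constant $\delta_s$ of $A$ is the smallest constant such that $(1-\delta_s)\|z\|_2^2\le\|Az\|_2^2\le(1+\delta_s)\|z\|_2^2$ for all $s$-sparse $z\in\mathbb{R}^n$. For $p\in(0,1)$, $\|\gamma\|_p=(\sum_i|\gamma_i|^p)^{1/p}$. For a vector $v$ and index set $T$, $v_T$ is the vector equal to $v$ on $T$ and zero elsewhere. $g(p)=\frac{p}{2}(1-\frac{p}{2})^{\frac{2}{p}-1}$. $p^{\star}\approx0.45418$ is the unique solution in $(0,1]$ of $(\frac{p}{2})^{1/2}(2-p)^{\frac1p-\frac12}=1$. *)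

(* Defs.v *)
From mathcomp Require Import all_boot all_order all_algebra.
From mathcomp Require Import all_classical all_reals all_analysis.
Set Implicit Arguments. Unset Strict Implicit. Unset Printing Implicit Defensive.
Import Order.TTheory GRing.Theory Num.Theory.
Local Open Scope ring_scope.

Section Defs.
Variable R : realType.

Definition l2norm (n : nat) (v : 'cV[R]_n) : R :=
  Num.sqrt (\sum_(i < n) (v i ord0) ^+ 2).

Definition lpnorm (p : R) (n : nat) (v : 'cV[R]_n) : R :=
  (\sum_(i < n) `|v i ord0| `^ p) `^ (1 / p).

Definition restr_vec (n : nat) (T : {set 'I_n}) (v : 'cV[R]_n) : 'cV[R]_n :=
  \col_i (if i \in T then v i ord0 else 0).

Definition sparse (s n : nat) (z : 'cV[R]_n) : Prop :=
  (#|[set i : 'I_n | z i ord0 != (0 : R)%R]| <= s)%N.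

Definition RIP_bound (m n s : nat) (A : 'M[R]_(m, n)) (d : R) : Prop :=
  forall z : 'cV[R]_n, sparse s z ->
    (1 - d) * (l2norm z) ^+ 2 <= (l2norm (A *m z)) ^+ 2 /\
    (l2norm (A *m z)) ^+ 2 <= (1 + d) * (l2norm z) ^+ 2.

Definition is_RIC (m n s : nat) (A : 'M[R]_(m, n)) (d : R) : Prop :=
  RIP_bound s A d /\ (forall d', RIP_bound s A d' -> d <= d').

Definition gfun (p : R) : R := p / 2 * (1 - p / 2) `^ (2 / p - 1).

Definition pstar_eq (p : R) : Prop :=
  (p / 2) `^ (1 / 2) * (2 - p) `^ (1 / p - 1 / 2) = 1.

Definition is_pstar (ps : R) : Prop :=
  0 < ps <= 1 /\ pstar_eq ps /\ (forall q, 0 < q <= 1 -> pstar_eq q -> q = ps).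

Definition Cfun (ps d p : R) : R :=
  if p <= ps then
    (((2 - d) `^ (1 - 2 / p) + 2 * d) * gfun p / (1 - d)) `^ (p / 2)
  else
    (((2 - d) `^ (1 - 2 / p) * gfun p + 2 `^ (2 - 2 / p) * d) / (1 - d)) `^ (p / 2).

Definition Dfun (ps d p : R) : R :=
  if p <= ps then
    ((2 + d) * gfun p / (1 - d)) `^ (p / 2)
  else
    (((2 - d) * gfun p + 2 `^ (2 - 2 / p) * d) / (1 - d)) `^ (p / 2).

Definition lp_minimizer (m n : nat) (p eps : R) (A : 'M[R]_(m, n))
    (y : 'cV[R]_m) (xs : 'cV[R]_n) : Prop :=
  l2norm (y - A *m xs) <= eps /\
  (forall g : 'cV[R]_n, l2norm (y - A *m g) <= eps -> lpnorm p xs <= lpnorm p g).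

End Defs.

(* Main.v *)
Require Import Defs.
From mathcomp Require Import all_boot all_order all_algebra.
From mathcomp Require Import all_classical all_reals all_analysis.
From mathcomp Require Import ring lra.
Import Order.TTheory GRing.Theory Num.Theory.
Local Open Scope ring_scope.

(* Let h = x - x*, let |T| = k, and split the complement of T into blocks
   B_0, B_1, ... of k entries of h, in decreasing order of modulus.  Write
   K = k^(1-2/p) |h_(T^c)|_p^2, X = sum_(j >= 1) |h_(B_j)|_2^2 and
   Y = (sum_(j >= 1) |h_(B_j)|_2)^2.  The restricted isometry property gives
   |A sum_(j >= 1) h_(B_j)|_2^2 <= X + delta Y, hence
   sqrt(1-delta) |h_(T u B_0)|_2 <= |Ah|_2 + sqrt(X + delta Y).
   Monotonicity of the blocks gives, for t >= 0,
     X - t |h_(B_0)|_2^2 <= (1+t)^(1-2/p) g(p) K   and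
     Y <= 2 max(g(p), 2^(1-2/p)) K.
   With t = 1 - delta this bounds |h_T|_2 by |Ah|_2 and C(p), and with t = 0 it
   bounds |h|_2 by |Ah|_2 and D(p); minimality of x* closes the loop through the
   cone inequality |h_(T^c)|_p^p <= |h_T|_p^p + 2 |x_(T^c)|_p^p.  The number p*
   is where the maximum switches from g(p) to 2^(1-2/p).  Nothing depends on the
   choice of T, and T containing the support of x yields exact recovery. *)

(** * Real powers, the function g and its comparison at p* *)

Section Powers.
Variable R : realType.
Implicit Types a b p r s u : R.

Lemma powRS a r : 0 <= a -> 0 <= r -> a `^ (1 + r) = a * a `^ r.
Proof.
move=> a0 r0; rewrite powRD ?powRr1//.
by apply/implyP => /eqP; lra.
Qed.

Lemma ler_powRl a b r : 0 <= r -> 0 <= a -> a <= b -> a `^ r <= b `^ r.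
Proof.
move=> r0 a0 ab; apply: ge0_ler_powR => //; rewrite nnegrE//.
exact: le_trans ab.
Qed.

(** Young's inequality for the product of a^p and 1, with exponents 1/p and 1/(1-p). *)
Lemma powR_le_tangent a p : 0 <= a -> 0 < p < 1 -> a `^ p <= 1 + p * (a - 1).
Proof.
move=> a0 /andP[p0 p1].
have := @conjugate_powR R (a `^ p) 1 p^-1 (1 - p)^-1 (powR_ge0 _ _) ler01.
rewrite !invr_gt0 !invrK subr_gt0 => /(_ p0 p1).
rewrite -powRrM mulfV ?gt_eqF// powRr1// powR1 !mulr1 => h.
by apply: le_trans (h _) _; lra.
Qed.

(** With s = a + b, each x in {a, b} has x/s in [0, 1], hence x/s <= (x/s)^p; the two inequalities
    are multiplied by s^p and added. *)
Lemma powRD_le a b p : 0 <= a -> 0 <= b -> 0 < p <= 1 ->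
  (a + b) `^ p <= a `^ p + b `^ p.
Proof.
move=> a0 b0 /andP[p0 p1].
have [s0|s0] := eqVneq (a + b) 0.
  by rewrite s0 powR0 ?gt_eqF// addr_ge0 ?powR_ge0.
have {}s0 : 0 < a + b by rewrite lt_neqAle eq_sym s0 addr_ge0.
have frac x : 0 <= x <= a + b -> x / (a + b) * (a + b) `^ p <= x `^ p.
  move=> /andP[x0 xs]; have [->|xn0] := eqVneq x 0.
    by rewrite !mul0r powR_ge0.
  have xq0 : 0 < x / (a + b) by rewrite divr_gt0// lt_neqAle eq_sym xn0.
  rewrite -{2}[x](divfK (lt0r_neq0 s0)) powRM ?(ltW xq0) ?(ltW s0)//.
  rewrite ler_wpM2r ?powR_ge0// ger1_powR// xq0 ler_pdivrMr// mul1r xs//.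
have := lerD (frac a _) (frac b _); rewrite -mulrDl -mulrDl divff ?gt_eqF// mul1r.
by apply; rewrite ?a0 ?b0 ?lerDl ?lerDr.
Qed.

Lemma gfun_ge0 p : 0 < p -> 0 <= gfun p.
Proof. by move=> p0; rewrite /gfun mulr_ge0 ?powR_ge0//; lra. Qed.

(** This is where g comes from: with r = 2/p - 1, the function s^r (1 - s) is maximal at s = 1 -
    p/2, with value g(p). After rescaling by v = s / (1 - p/2) the claim becomes v^r (1 - r(v-1)) <=
    1, which follows from ln v <= v - 1 and 1 + x <= e^x. *)
Lemma powR_mul_sub_le_gfun p s : 0 < p < 2 -> 0 <= s ->
  s `^ (2 / p - 1) * (1 - s) <= gfun p.
Proof.
move=> /andP[p0 p2] s0; set r := 2 / p - 1.
have rE : r = (2 - p) / p by rewrite /r mulrBl divff ?gt_eqF.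
have r0 : 0 < r by rewrite rE divr_gt0 ?subr_gt0.
have [->|sn0] := eqVneq s 0.
  by rewrite powR0 ?gt_eqF// mul0r gfun_ge0.
have {}s0 : 0 < s by rewrite lt_neqAle eq_sym sn0.
have c0 : 0 < 1 - p / 2 by lra.
set v := s / (1 - p / 2).
have v0 : 0 < v by rewrite divr_gt0.
have sE : s = (1 - p / 2) * v by rewrite /v mulrC divfK ?gt_eqF.
have s1E : 1 - s = p / 2 * (1 + - (r * (v - 1))).
  by rewrite sE rE; field; rewrite gt_eqF.
have vr : v `^ r <= expR (r * (v - 1)).
  rewrite /powR gt_eqF// ler_expR ler_pM2l//.
  by have := @le_ln1Dx R (v - 1); rewrite subrKC; apply; lra.
rewrite s1E {1}sE powRM ?(ltW v0) ?(ltW c0)// /gfun -/r mulrCA ler_pM2l; last by lra.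
rewrite -mulrA -[leRHS]mulr1 ler_wpM2l ?powR_ge0//.
apply: le_trans (_ : v `^ r * expR (- (r * (v - 1))) <= _).
  by rewrite ler_wpM2l ?powR_ge0// expR_ge1Dx.
rewrite expRN ler_pdivrMr ?expR_gt0// mul1r//.
Qed.

Lemma pstar_eqE p : 0 < p < 2 -> pstar_eq p ->
  p / 2 * (2 - p) `^ (2 / p - 1) = 1.
Proof.
move=> /andP[p0 p2] e; have := congr1 (fun x => x ^+ 2) e.
rewrite expr1n exprMn -!powR_mulrn ?powR_ge0// -!powRrM mul1r mulVf//.
rewrite powRr1; last by lra.
by move=> h; rewrite -[RHS]h; congr (_ * _ `^ _); field; rewrite gt_eqF.
Qed.

Lemma gfun_rescale p : 0 < p < 2 ->
  2 `^ (2 / p - 1) * gfun p = p / 2 * (2 - p) `^ (2 / p - 1).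
Proof.
move=> /andP[p0 p2]; rewrite /gfun mulrCA -powRM; [|lra..].
by congr (_ * _ `^ _); field.
Qed.

(** Monotonicity without derivatives. Since 2 - q >= 1, the exponent 2/q - 1 may be raised to 2/p -
    1; the result is 2^(2/p-1) times s^(2/p-1) (1 - s) at s = 1 - q/2, which is at most the maximum
    g(p). The rescaled function takes the value 1 at p*. *)
Lemma gfun_rescale_le p q : 0 < p <= q -> q <= 1 ->
  2 `^ (2 / q - 1) * gfun q <= 2 `^ (2 / p - 1) * gfun p.
Proof.
move=> /andP[p0 pq] q1; have q0 : 0 < q by exact: lt_le_trans pq.
rewrite (@gfun_rescale q); [|lra..].
apply: (@le_trans _ _ (q / 2 * (2 - q) `^ (2 / p - 1))).
  rewrite ler_wpM2l ?ler_powR//; [lra..|].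
  by rewrite lerB// ler_pM2l// lef_pV2.
have -> : q / 2 * (2 - q) `^ (2 / p - 1) =
    2 `^ (2 / p - 1) * ((1 - q / 2) `^ (2 / p - 1) * (1 - (1 - q / 2))).
  rewrite mulrA -powRM; [|lra..].
  by rewrite mulrC; congr (_ `^ _ * _); field.
rewrite ler_wpM2l ?powR_ge0//; apply: powR_mul_sub_le_gfun; lra.
Qed.

Lemma gfun_ge_pstar ps p : is_pstar ps -> 0 < p <= ps ->
  2 `^ (1 - 2 / p) <= gfun p.
Proof.
move=> [/andP[ps0 ps1] [e _]] pps; have := @gfun_rescale_le p ps pps ps1.
have ps02 : 0 < ps < 2 by lra.
rewrite (gfun_rescale _ ps02) pstar_eqE// => h; rewrite -opprB powRN.
by rewrite -[leLHS]mul1r ler_pdivrMr ?powR_gt0// mulrC.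
Qed.

Lemma gfun_le_pstar ps p : is_pstar ps -> ps <= p <= 1 ->
  gfun p <= 2 `^ (1 - 2 / p).
Proof.
move=> [/andP[ps0 ps1] [e _]] /andP[pps p1].
have := @gfun_rescale_le ps p; rewrite ps0 => /(_ pps p1).
have ps02 : 0 < ps < 2 by lra.
rewrite (gfun_rescale _ ps02) pstar_eqE// => h; rewrite -opprB powRN.
by rewrite -[leRHS]mul1r ler_pdivlMr ?powR_gt0// mulrC.
Qed.

End Powers.

(** * Sums over decreasing sequences *)

Section Decreasing.
Variable R : realType.

(** Let u be the least value of b on B, so that u also bounds b on C. Replacing values by u bounds
    the left side by u^r (P - K u), where P is the total sum and K = (1+t)|B|. Substituting s = K u
    / P leaves s^r (1 - s), whose maximum is g(p). *)
Lemma tail_sum_le (I : finType) (b : I -> R) (B C : {set I}) (p t : R) :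
  0 < p < 2 -> 0 <= t -> (0 < #|B|)%N -> (forall i, 0 <= b i) ->
  (forall i j, i \in B -> j \in C -> b j <= b i) ->
  \sum_(i in C) b i `^ (2 / p) - t * \sum_(i in B) b i `^ (2 / p) <=
  gfun p * ((1 + t) * #|B|%:R) `^ (1 - 2 / p) *
  (\sum_(i in B) b i + \sum_(i in C) b i) `^ (2 / p).
Proof.
move=> /andP[p0 p2] t0 B0 b0 BC; set r := 2 / p - 1.
have r0 : 0 < r by rewrite subr_gt0 ltr_pdivlMr// mul1r.
have -> : 2 / p = 1 + r by rewrite /r; ring.
have -> : 1 - (1 + r) = - r by ring.
have [x0 Bx0] : exists x, x \in B by apply/set0Pn; rewrite -card_gt0.
have [u [u0 uB uC]] : exists u : R, [/\ 0 <= u, forall i, i \in B -> u <= b i &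
    forall i, i \in C -> b i <= u].
  case: (Order.TotalTheory.arg_minP b Bx0) => x Bx xmin; exists (b x); split => //.
  by move=> i; exact: BC.
set P := \sum_(i in B) b i + _; set K := (1 + t) * _.
have K0 : 0 < K by rewrite mulr_gt0 ?ltr0n//; lra.
have BE (f : I -> R) z : (forall i, i \in B -> z <= f i) ->
    #|B|%:R * z <= \sum_(i in B) f i.
  by move=> zf; rewrite mulr_natl -sumr_const ler_sum.
have uP : #|B|%:R * u <= P.
  by rewrite (le_trans (BE _ _ uB))// lerDl sumr_ge0.
have P0 : 0 <= P by rewrite (le_trans _ uP)// mulr_ge0.
apply: (@le_trans _ _ (u `^ r * (P - K * u))).
  have hC : \sum_(i in C) b i `^ (1 + r) <= u `^ r * \sum_(i in C) b i.
    rewrite mulr_sumr ler_sum// => i iC.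
    rewrite powRS ?(ltW r0)// mulrC ler_wpM2r//.
    by rewrite ler_powRl ?(ltW r0)//; exact: uC.
  have hB : #|B|%:R * (u * u `^ r) <= \sum_(i in B) b i `^ (1 + r).
    apply: BE => i iB; rewrite -powRS ?(ltW r0)//.
    by rewrite ler_powRl ?uB//; lra.
  have hP : u `^ r * (#|B|%:R * u) <= u `^ r * \sum_(i in B) b i.
    by rewrite ler_wpM2l ?powR_ge0// BE.
  have := ler_wpM2l t0 hB; rewrite /P /K; lra.
have [PE|Pn0] := eqVneq P 0.
  have -> : u = 0.
    apply/eqP; rewrite eq_le u0 andbT -(@ler_pM2l _ #|B|%:R) ?ltr0n//.
    by rewrite mulr0 (le_trans uP)// PE.
  rewrite powR0 ?gt_eqF// mul0r.
  by do 2?apply: mulr_ge0; rewrite ?gfun_ge0 ?powR_ge0.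
have {Pn0}P0 : 0 < P by rewrite lt_neqAle eq_sym Pn0.
pose s := K * u / P.
have s0 : 0 <= s.
  rewrite /s; apply: divr_ge0; rewrite ?(ltW P0)//.
  by apply: mulr_ge0; rewrite ?(ltW K0).
have uE : u = s * (P * K^-1).
  by rewrite /s; field; rewrite !gt_eqF.
have KuE : P - K * u = P * (1 - s).
  by rewrite /s; field; rewrite gt_eqF.
have K0' : 0 <= K^-1 by rewrite invr_ge0 ltW.
rewrite KuE {1}uE powRM//; last by apply: mulr_ge0; rewrite ?(ltW P0).
rewrite powRM ?(ltW P0)// powRS ?(ltW P0) ?(ltW r0)//.
rewrite -(powR_inv1 (ltW K0)) -powRrM mulN1r.
have -> : s `^ r * (P `^ r * K `^ (- r)) * (P * (1 - s)) =
  s `^ r * (1 - s) * (K `^ (- r) * (P * P `^ r)) by ring.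
rewrite -[leRHS]mulrA ler_wpM2r//.
  apply/mulr_ge0; first exact: powR_ge0.
  by apply: mulr_ge0; rewrite ?powR_ge0 ?(ltW P0).
by apply: powR_mul_sub_le_gfun => //; rewrite p0.
Qed.

(** By the arithmetic-geometric mean inequality each inner term is counted twice with weight 1/2,
    and the two end terms once. *)
Lemma sum_sqrt_neighbours_le (q : nat -> R) l : (forall j, 0 <= q j) ->
  \sum_(j < l) Num.sqrt (q j * q j.+1) <= \sum_(j < l.+1) q j - q 0%N / 2.
Proof.
move=> q0; apply: (@le_trans _ _ (\sum_(j < l) (q j + q j.+1) / 2)).
  apply: ler_sum => j _.
  rewrite -[leRHS]ger0_norm ?divr_ge0 ?addr_ge0// -sqrtr_sqr.
  rewrite ler_wsqrtr// -subr_ge0.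
  have -> : ((q j + q j.+1) / 2) ^+ 2 - q j * q j.+1 = ((q j - q j.+1) / 2) ^+ 2.
    by field.
  exact: sqr_ge0.
rewrite -mulr_suml big_split/=.
have h1 : \sum_(j < l.+1) q j = q 0%N + \sum_(j < l) q j.+1 by rewrite big_ord_recl.
have h2 : \sum_(j < l.+1) q j = \sum_(j < l) q j + q l by rewrite big_ord_recr.
by have := q0 l; lra.
Qed.

Lemma sum_chain_le_head (q : nat -> R) (s : R) l : 0 <= s ->
  (forall j, 0 <= q j) -> (forall j, q j.+1 <= q j) ->
  \sum_(j < l) q j `^ s * Num.sqrt (q j * q j.+1) <=
  q 0%N `^ s * (\sum_(j < l.+1) q j - q 0%N / 2).
Proof.
move=> s0 q0 qS; apply: le_trans (_ : q 0%N `^ s *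
    \sum_(j < l) Num.sqrt (q j * q j.+1) <= _); last first.
  by rewrite ler_wpM2l ?powR_ge0 ?sum_sqrt_neighbours_le.
rewrite mulr_sumr ler_sum// => j _; rewrite ler_wpM2r ?sqrtr_ge0//.
rewrite ler_powRl//; elim: (nat_of_ord j) => // i; exact: le_trans.
Qed.

(** The head bound reads q_0^s (1 - q_0/2) with s = 1/p - 1. It suffices when q_0 <= 1/2 or s <= 1;
    otherwise the first summand is estimated separately through g(p). *)
Lemma sum_chain_normalized_le (q : nat -> R) (p c : R) l : 0 < p < 1 ->
  0 <= c -> 2 * gfun p <= c ^+ 2 -> 2 `^ (1 - 1 / p) <= c ->
  (forall j, 0 <= q j) -> (forall j, q j.+1 <= q j) ->
  \sum_(j < l.+1) q j = 1 ->
  \sum_(j < l) q j `^ (1 / p - 1) * Num.sqrt (q j * q j.+1) <= c.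
Proof.
move=> /andP[p0 p1] c0 gc c2 q0 qS q1; set s := 1 / p - 1.
have s0 : 0 < s by rewrite subr_gt0 ltr_pdivlMr// mul1r.
have {}c2 : 2 `^ (- s) <= c by rewrite /s opprB.
have head := @sum_chain_le_head q s l (ltW s0) q0 qS.
have q01 : q 0%N <= 1.
  by rewrite -q1 big_ord_recl lerDl sumr_ge0.
have half (x : R) a : 0 <= a -> 0 <= x <= 2^-1 -> x `^ a <= 2 `^ (- a).
  move=> a0 /andP[x0 x2]; rewrite -(mulN1r a) powRrM powR_inv1//.
  by rewrite ler_powRl.
have [u2|u2] := leP (q 0%N) 2^-1.
  apply: le_trans head _; rewrite q1; apply: le_trans c2.
  rewrite -[leRHS]mulr1; apply: ler_pM; rewrite ?powR_ge0//.
  - by have := q0 0%N; lra.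
  - by apply: half; rewrite ?q0// ltW.
  - by have := q0 0%N; lra.
(* Here 2 q_0 >= 1 and s <= 1 give (2 q_0)^s <= 2 q_0, and 2 q_0 (1 - q_0/2) = 1 - (1 - q_0)^2 <=
   1. *)
have [s1|s1] := leP s 1.
  apply: le_trans head _; rewrite q1; apply: le_trans c2.
  have h : q 0%N `^ s <= 2 `^ (- s) * (2 * q 0%N).
    rewrite -(mulN1r s) (powRrM 2) powR_inv1// -[in leLHS](mulKf (_ : 2 != 0) (q 0%N))//.
    rewrite powRM//; last by lra.
    rewrite ler_wpM2l ?powR_ge0//; apply: ler1_powR => //; lra.
  apply: (@le_trans _ _ (2 `^ (- s) * (2 * q 0%N) * (1 - q 0%N / 2))).
    by rewrite ler_wpM2r//; lra.
  rewrite -mulrA ler_piMr ?powR_ge0//.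
  by have := sqr_ge0 (1 - q 0%N); lra.
case: l q1 {head} => [|l] q1; first by rewrite big_ord0.
rewrite big_ord_recl/=.
set rest := \sum_(i < l) _.
have q1E : \sum_(j < l.+1) q j.+1 = 1 - q 0%N.
  by move: q1; rewrite big_ord_recl/= => <-; rewrite addrC addKr.
have q1R : q 1%N <= 1 - q 0%N.
  by rewrite -q1E big_ord_recl/= lerDl sumr_ge0.
(* The head bound for the shifted sequence, of mass 1 - q_0 < 1/2: one factor q_1 is split off,
   q_1^(s-1) <= 2 * 2^(-s) <= 2 c, and the remaining product is at most (1 - q_0)^2 / 2 <= 1/8. *)
have hrest : rest <= c / 4.
  apply: le_trans (@sum_chain_le_head (fun j => q j.+1) s l (ltW s0) _ _) _ => //=.
  have -> : s = 1 + (s - 1) by ring.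
  rewrite q1E powRS ?q0 ?subr_ge0 ?(ltW s1)//.
  have hp : q 1%N `^ (s - 1) <= 2 * c.
    apply: le_trans (half _ _ _ _) _; rewrite ?q0 ?subr_ge0 ?(ltW s1)//=; first lra.
    have -> : - (s - 1) = 1 - s by ring.
    by rewrite powRD ?powRr1 ?pnatr_eq0 ?implybT//; lra.
  have hq : q 1%N * (1 - q 0%N - q 1%N / 2) <= 8^-1.
    have := q0 1%N; nra.
  have hq0 : 0 <= q 1%N * (1 - q 0%N - q 1%N / 2).
    by rewrite mulr_ge0//; have := q0 1%N; lra.
  rewrite mulrAC mulrC.
  have := powR_ge0 (q 1%N) (s - 1).
  by move=> hh; have := ler_pM hh hq0 hp hq; lra.
(* The square is at most q_0^(2s+1) (1 - q_0) <= g(p) <= c^2 / 2, because 2s + 1 = 2/p - 1; and 1/2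
   <= (3/4)^2. *)
have hfst : q 0%N `^ s * Num.sqrt (q 0%N * q 1%N) <= 3 / 4 * c.
  rewrite -(@ler_pXn2r _ 2)// ?nnegrE ?mulr_ge0 ?powR_ge0 ?sqrtr_ge0//.
  rewrite exprMn sqr_sqrtr ?mulr_ge0//.
  apply: (@le_trans _ _ (gfun p)); last by rewrite exprMn; have := sqr_ge0 c; lra.
  apply: le_trans (@powR_mul_sub_le_gfun R p (q 0%N) _ (q0 _)); last by lra.
  rewrite -powR_mulrn ?powR_ge0// -powRrM.
  have -> : 2 / p - 1 = 1 + s * 2 by rewrite /s; field; rewrite gt_eqF.
  rewrite powRS//; last by lra.
  rewrite mulrA [_ * q 0%N]mulrC ler_wpM2l//.
  by rewrite mulr_ge0 ?powR_ge0.
by lra.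
Qed.

(** Both sides are homogeneous of degree 1/p in q, so the total can be scaled to 1. *)
Lemma sum_chain_le (q : nat -> R) (p c : R) l : 0 < p < 1 ->
  0 <= c -> 2 * gfun p <= c ^+ 2 -> 2 `^ (1 - 1 / p) <= c ->
  (forall j, 0 <= q j) -> (forall j, q j.+1 <= q j) ->
  \sum_(j < l) q j `^ (1 / p - 1) * Num.sqrt (q j * q j.+1) <=
  c * (\sum_(j < l.+1) q j) `^ (1 / p).
Proof.
move=> p01 c0 gc c2 q0 qS; set P := \sum_(j < l.+1) _.
have [p0 p1] := andP p01.
have [P0|Pn0] := eqVneq P 0.
  have qj0 (j : 'I_l) : q j = 0.
    have /(_ (widen_ord (leqnSn l) j) isT) := psumr_eq0P (fun i _ => q0 _) P0.
    exact.
  by rewrite big1 ?mulr_ge0 ?powR_ge0// => j _; rewrite qj0 mul0r sqrtr0 mulr0.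
have P0 : 0 < P by rewrite lt_neqAle eq_sym Pn0 sumr_ge0.
have := @sum_chain_normalized_le (fun j => q j / P) p c l p01 c0 gc c2.
have hq j : 0 <= q j / P by rewrite divr_ge0 ?(ltW P0).
move=> /(_ hq); rewrite -mulr_suml divff//.
have hS j : q j.+1 / P <= q j / P by rewrite ler_pM2r ?invr_gt0.
move=> /(_ hS erefl) h.
have s0 : 0 <= 1 / p - 1 by rewrite subr_ge0 ler_pdivlMr// mul1r ltW.
rewrite -ler_pdivrMr ?powR_gt0//; apply: le_trans h.
rewrite mulr_suml ler_sum// => j _.
have -> : Num.sqrt (q j / P * (q j.+1 / P)) = P^-1 * Num.sqrt (q j * q j.+1).
  have -> : q j / P * (q j.+1 / P) = (P^-1) ^+ 2 * (q j * q j.+1) by ring.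
  by rewrite sqrtrM ?sqr_ge0// sqrtr_sqr ger0_norm ?invr_ge0 ?(ltW P0).
have -> : P `^ (1 / p) = P * P `^ (1 / p - 1).
  by rewrite -powRS ?(ltW P0)//; congr (_ `^ _); ring.
rewrite powRM ?invr_ge0 ?(ltW P0)// -(powR_inv1 (ltW P0)) -powRrM mulN1r powRN.
by rewrite powR_inv1 ?(ltW P0)// invfM le_eqVlt; apply/predU1P; left; ring.
Qed.

End Decreasing.

(** * Cutting a finite set into blocks of decreasing values *)

Lemma top_subset (disp : Order.disp_t) (V : orderType disp) (I : finType)
  (b : I -> V) (T : {set I}) (k : nat) :
  (k <= #|T|)%N -> exists B : {set I}, [/\ B \subset T, #|B| = k &
  forall i j, i \in B -> j \in T :\: B -> (b j <= b i)%O].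
Proof.
elim: k => [|k IH] kT.
  by exists finset.set0; split; rewrite ?finset.sub0set ?cards0// => i j; rewrite inE.
have [B [BT Bk Bmax]] := IH (ltnW kT).
have [x0 x0T] : exists x, x \in T :\: B.
  by apply/set0Pn; rewrite -card_gt0 cardsDS// Bk subn_gt0.
case: (Order.TotalTheory.arg_maxP b x0T) => x xT xmax.
have : x \in T :\: B by [].
rewrite inE => /andP[xB xT'].
(* A maximal remaining element joins the set; the earlier elements already dominate everything
   left. *)
exists (x |: B); split.
- by rewrite finset.subUset finset.sub1set xT'.
- by rewrite cardsU1 xB Bk.
move=> i j; rewrite !inE negb_or => /orP[/eqP->|iB] /andP[/andP[jx jB] jT].
  by apply: xmax; apply/setDP.
by apply: Bmax => //; rewrite inE jB.
Qed.

Section Blocks.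
Variables (R : realType) (I : finType) (b : I -> R).
Implicit Types (B T : {set I}) (k l : nat).

(** The partition is expressed by a summation identity in any commutative monoid: it then serves for
    real sums, for the splitting of a vector, and, through indicator functions, for membership. *)
Lemma decreasing_blocks T k l : #|T| = (l * k)%N ->
  exists B : nat -> {set I}, [/\ forall j, B j \subset T,
    forall j, (j < l)%N -> #|B j| = k,
    forall i j, (i < j)%N -> [disjoint B i & B j],
    forall i j x y, (i < j)%N -> x \in B i -> y \in B j -> b y <= b x &
    forall (V : nmodType) (f : I -> V),
      \sum_(x in T) f x = \sum_(j < l) \sum_(x in B j) f x].
Proof.
elim: l T => [|l IH] T cT.
  have -> : T = finset.set0 by apply/eqP; rewrite -cards_eq0 cT.
  (* Blocks beyond the last are empty, so disjointness and order hold for all indices. *)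
  exists (fun=> finset.set0); split => //.
  - by move=> i j _; rewrite finset.disjoints_subset finset.sub0set.
  - by move=> i j x y _; rewrite inE.
  - by move=> V f; rewrite finset.big_set0 big_ord0.
have [|B0 [B0T B0k B0max]] := @top_subset _ _ _ b T k; first by rewrite cT leq_addr.
have [|B [BT Bk Bd Bmax Bsum]] := IH (T :\: B0).
  by rewrite cardsDS// B0k cT mulSn addKn.
exists (fun j => if j is i.+1 then B i else B0); split.
- by case=> // j; apply: fintype.subset_trans (BT j) (finset.subsetDl _ _).
- by case=> // j; exact: Bk.
- case=> [|i] [|j]//; last by move=> ij; apply: Bd.
  move=> _; rewrite disjoint_sym finset.disjoints_subset.
  by apply: fintype.subset_trans (BT j) _; rewrite finset.setDE finset.subsetIr.
- case=> [|i] [|j] x y//; last by move=> ij; apply: Bmax.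
  by move=> _ xB /(fintype.subsetP (BT j)); exact: B0max.
- move=> V f; rewrite big_ord_recl/= -Bsum (big_setID B0)/=.
  by rewrite (finset.setIidPr B0T).
Qed.

(** With q_j the mean of b over block j, every value in block j+1 is at most q_j. The sum of b^(2/p)
    over block j+1 is therefore at most k q_j^(2/p-1) q_(j+1), whose square root is the summand of
    [sum_chain_le] times sqrt(k). *)
Lemma sum_block_norms_le (B : nat -> {set I}) (p c : R) k l : 0 < p < 1 ->
  0 <= c -> 2 * gfun p <= c ^+ 2 -> 2 `^ (1 - 1 / p) <= c -> (0 < k)%N ->
  (forall i, 0 <= b i) ->
  (forall j, (j < l.+1)%N -> #|B j| = k) ->
  (forall i j x y, (i < j)%N -> x \in B i -> y \in B j -> b y <= b x) ->
  (\sum_(j < l) Num.sqrt (\sum_(x in B j.+1) b x `^ (2 / p))) ^+ 2 <=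
  c ^+ 2 * (k%:R `^ (1 - 2 / p) *
            (\sum_(j < l.+1) \sum_(x in B j) b x) `^ (2 / p)).
Proof.
move=> /andP[p0 p1] c0 gc c2 k0 b0 Bk Bmax.
have kR : 0 < k%:R :> R by rewrite ltr0n.
(* The value 0 past the last block keeps q nonnegative and decreasing at every index. *)
pose q j := if (j < l.+1)%N then (\sum_(x in B j) b x) / k%:R else 0.
have q0 j : 0 <= q j.
  by rewrite /q; case: ifP => // _; rewrite divr_ge0 ?(ltW kR)// sumr_ge0.
have bq j y : (j < l)%N -> y \in B j.+1 -> b y <= q j.
  move=> jl yB; rewrite /q ltnS (ltnW jl) ler_pdivlMr//.
  rewrite mulr_natr -(Bk j (ltnW jl)) -sumr_const ler_sum// => x xB.
  exact: Bmax xB yB.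
have qS j : q j.+1 <= q j.
  have [jl|jl] := ltnP j l; last by rewrite {1}/q ltnS ltnNge jl.
  rewrite {1}/q ltnS jl ler_pdivrMr// mulr_natr -(Bk _ (_ : j.+1 < l.+1)%N)//.
  by rewrite -sumr_const ler_sum// => y; exact: bq.
set r := 2 / p - 1.
have r0 : 0 < r by rewrite subr_gt0 ltr_pdivlMr// mul1r; lra.
have qsum : \sum_(j < l.+1) q j = (\sum_(j < l.+1) \sum_(x in B j) b x) / k%:R.
  by rewrite mulr_suml; apply: eq_bigr => j _; rewrite /q ltn_ord.
set S := \sum_(j < l.+1) \sum_(x in B j) b x in qsum *.
have S0 : 0 <= S by rewrite sumr_ge0// => j _; rewrite sumr_ge0.
have step (j : 'I_l) : Num.sqrt (\sum_(x in B j.+1) b x `^ (2 / p)) <=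
    Num.sqrt k%:R * (q j `^ (1 / p - 1) * Num.sqrt (q j * q j.+1)).
  have -> : q j `^ (1 / p - 1) = Num.sqrt (q j `^ (1 / p - 1) ^+ 2).
    by rewrite sqrtr_sqr ger0_norm ?powR_ge0.
  rewrite -!sqrtrM ?sqr_ge0 ?ler0n// ler_wsqrtr//.
  rewrite -powR_mulrn ?powR_ge0// -powRrM.
  have -> : k%:R * (q j `^ ((1 / p - 1) * 2) * (q j * q j.+1)) =
      (q j * q j `^ ((1 / p - 1) * 2)) * (k%:R * q j.+1) by ring.
  rewrite -powRS ?q0//; last first.
    by rewrite mulr_ge0// subr_ge0 ler_pdivlMr// mul1r ltW.
  have -> : 1 + (1 / p - 1) * 2 = r by rewrite /r; ring.
  have -> : k%:R * q j.+1 = \sum_(x in B j.+1) b x.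
    by rewrite /q ltnS ltn_ord mulrC divfK ?gt_eqF.
  rewrite mulr_sumr ler_sum// => y yB.
  have -> : 2 / p = 1 + r by rewrite /r; ring.
  rewrite powRS ?b0 ?(ltW r0)// mulrC ler_wpM2r//.
  by rewrite ler_powRl ?(ltW r0)// bq.
have p01 : 0 < p < 1 by rewrite p0.
have chain := @sum_chain_le R q p c l p01 c0 gc c2 q0 qS.
have : \sum_(j < l) Num.sqrt (\sum_(x in B j.+1) b x `^ (2 / p)) <=
    Num.sqrt k%:R * (c * (S / k%:R) `^ (1 / p)).
  rewrite -qsum; apply: le_trans (ler_sum _ (fun j _ => step j)) _.
  by rewrite -mulr_sumr ler_wpM2l ?sqrtr_ge0.
set N := \sum_(j < l) _ => hN.
have N0 : 0 <= N by rewrite sumr_ge0// => j _; rewrite sqrtr_ge0.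
have := ler_pM N0 N0 hN hN; rewrite -!expr2 => /le_trans; apply.
rewrite !exprMn sqr_sqrtr ?ler0n// -(@powR_mulrn _ ((S / _) `^ _)) ?powR_ge0// -powRrM.
have -> : 1 / p * 2 = 2 / p by field; rewrite gt_eqF.
rewrite powRM ?invr_ge0 ?ler0n// -(powR_inv1 (ltW kR)) -powRrM mulN1r.
rewrite (@powRD _ _ 1) ?powRr1 ?(ltW kR)//; last by rewrite pnatr_eq0 -lt0n k0 implybT.
by rewrite le_eqVlt; apply/predU1P; left; ring.
Qed.
End Blocks.

(** * Euclidean norm and inner product *)

Section Vectors.
Local Set Implicit Arguments. Local Unset Strict Implicit.
Variable R : realType.

Definition dotv n (u v : 'cV[R]_n) : R := \sum_(i < n) u i ord0 * v i ord0.

Lemma l2norm_ge0 n (v : 'cV[R]_n) : 0 <= l2norm v.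
Proof. exact: sqrtr_ge0. Qed.

Lemma l2norm_sqr n (v : 'cV[R]_n) : l2norm v ^+ 2 = \sum_(i < n) v i ord0 ^+ 2.
Proof. by rewrite sqr_sqrtr// sumr_ge0// => i _; rewrite sqr_ge0. Qed.

Lemma l2norm_dotv n (v : 'cV[R]_n) : l2norm v ^+ 2 = dotv v v.
Proof. by rewrite l2norm_sqr; apply: eq_bigr => i _; rewrite expr2. Qed.

Lemma l2norm_eq0 n (v : 'cV[R]_n) : l2norm v = 0 -> v = 0.
Proof.
move=> v0; apply/colP => i; rewrite mxE.
have : l2norm v ^+ 2 = 0 by rewrite v0 expr0n.
rewrite l2norm_sqr => /psumr_eq0P => /(_ (fun i _ => sqr_ge0 _)) /(_ i isT).
by move/eqP; rewrite sqrf_eq0 => /eqP.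
Qed.

Lemma dotv0 n (u : 'cV[R]_n) : dotv u 0 = 0.
Proof. by rewrite /dotv big1// => i _; rewrite mxE mulr0. Qed.

Lemma dotvC n (u v : 'cV[R]_n) : dotv u v = dotv v u.
Proof. by apply: eq_bigr => i _; rewrite mulrC. Qed.

Lemma dotv_suml n l (u : 'I_l -> 'cV[R]_n) v :
  dotv (\sum_j u j) v = \sum_j dotv (u j) v.
Proof.
rewrite /dotv exchange_big/=; apply: eq_bigr => i _.
by rewrite summxE mulr_suml.
Qed.

Lemma l2norm_comb_sqr n (a c : R) (u v : 'cV[R]_n) :
  l2norm (a *: u + c *: v) ^+ 2 =
  a ^+ 2 * l2norm u ^+ 2 + c ^+ 2 * l2norm v ^+ 2 + 2 * (a * c) * dotv u v.
Proof.
rewrite !l2norm_sqr /dotv !mulr_sumr -!big_split/=.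
by apply: eq_bigr => i _; rewrite !mxE; ring.
Qed.

(* Rescaling [u] and [v] to unit length, with the degenerate cases included. *)
Lemma dotv_le_scaled n m (f : 'cV[R]_n -> 'cV[R]_m) (d : R) (u v : 'cV[R]_n) :
  (u = 0 \/ v = 0 -> dotv (f u) (f v) <= 0) ->
  (let s := l2norm u in let t := l2norm v in
   2 * (s * t) * dotv (f u) (f v) <= d * (2 * (s * t) ^+ 2)) ->
  dotv (f u) (f v) <= d * (l2norm u * l2norm v).
Proof.
move=> f0 /= h.
have [u0|un0] := eqVneq (l2norm u) 0.
  by rewrite u0 mul0r mulr0; apply: f0; left; exact: l2norm_eq0.
have [v0|vn0] := eqVneq (l2norm v) 0.
  by rewrite v0 !mulr0; apply: f0; right; exact: l2norm_eq0.
have uv0 : 0 < l2norm u * l2norm v.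
  by rewrite lt_neqAle eq_sym mulf_neq0// mulr_ge0 ?l2norm_ge0.
rewrite -(@ler_pM2l _ (2 * (l2norm u * l2norm v))); last exact: mulr_gt0.
by apply: le_trans h _; rewrite le_eqVlt; apply/predU1P; left; ring.
Qed.

(** Cauchy-Schwarz, by expanding the squared norm of |v| u - |u| v. *)
Lemma dotv_le n (u v : 'cV[R]_n) : dotv u v <= l2norm u * l2norm v.
Proof.
rewrite -[leRHS]mul1r; apply: (@dotv_le_scaled _ _ id) => [[->|->]|/=].
- by rewrite dotvC dotv0.
- by rewrite dotv0.
have := sqr_ge0 (l2norm (l2norm v *: u + - l2norm u *: v)).
rewrite l2norm_comb_sqr; lra.
Qed.

Lemma ler_l2normD n (u v : 'cV[R]_n) : l2norm (u + v) <= l2norm u + l2norm v.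
Proof.
rewrite -(@ler_pXn2r _ 2)// ?nnegrE ?addr_ge0 ?l2norm_ge0//.
rewrite -[u]scale1r -[v]scale1r l2norm_comb_sqr !scale1r.
have := dotv_le u v; lra.
Qed.

Lemma l2normN n (u : 'cV[R]_n) : l2norm (- u) = l2norm u.
Proof. by congr Num.sqrt; apply: eq_bigr => i _; rewrite mxE sqrrN. Qed.

Lemma l2norm_restr_sqr n (T : {set 'I_n}) (v : 'cV[R]_n) :
  l2norm (restr_vec T v) ^+ 2 = \sum_(i in T) v i ord0 ^+ 2.
Proof.
rewrite l2norm_sqr [RHS]big_mkcond; apply: eq_bigr => i _.
by rewrite mxE; case: ifP => // _; rewrite expr0n.
Qed.

Lemma dotv_restr_disjoint n (S T : {set 'I_n}) (u v : 'cV[R]_n) :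
  [disjoint S & T] -> dotv (restr_vec S u) (restr_vec T v) = 0.
Proof.
move=> dST; rewrite /dotv big1// => i _; rewrite !mxE.
case: (boolP (i \in S)) => [iS|]; last by rewrite mul0r.
by rewrite (disjointFr dST iS) mulr0.
Qed.

Lemma sparse_supp n s (T : {set 'I_n}) (z : 'cV[R]_n) : (#|T| <= s)%N ->
  (forall i, i \notin T -> z i ord0 = 0) -> sparse s z.
Proof.
move=> Ts zT; apply: leq_trans Ts; apply: subset_leq_card.
apply/fintype.subsetP => i; rewrite inE; apply: contraNT => /zT ->.
by rewrite eqxx.
Qed.

(** * Consequences of the restricted isometry property *)

Section Rip.
Variables (m n k : nat) (A : 'M[R]_(m, n)) (d : R).
Hypothesis ripA : RIP_bound (2 * k) A d.
Implicit Types (S T : {set 'I_n}) (v : 'cV[R]_n).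

(** Polarisation: with u and w scaled to equal norms, u + w and u - w are [2 * k]-sparse and have
    the same norm, as u and w are orthogonal. The upper bound for the sum and the lower bound for
    the difference leave only d. *)
Lemma rip_dotv_disjoint S T v : (#|S| <= k)%N -> (#|T| <= k)%N ->
  [disjoint S & T] ->
  dotv (A *m restr_vec S v) (A *m restr_vec T v) <=
  d * (l2norm (restr_vec S v) * l2norm (restr_vec T v)).
Proof.
move=> Sk Tk dST; apply: dotv_le_scaled => [[->|->]|/=].
- by rewrite mulmx0 dotvC dotv0.
- by rewrite mulmx0 dotv0.
set u := restr_vec S v; set w := restr_vec T v.
have rip (a c : R) : (1 - d) * l2norm (a *: u + c *: w) ^+ 2 <=
    l2norm (a *: (A *m u) + c *: (A *m w)) ^+ 2 <=
    (1 + d) * l2norm (a *: u + c *: w) ^+ 2.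
  rewrite !scalemxAr -mulmxDr; apply/andP.
  apply: ripA; apply: (@sparse_supp _ _ (S :|: T)).
    by rewrite mul2n -addnn (leq_trans (leq_card_setU _ _))// leq_add.
  move=> i; rewrite inE negb_or !mxE => /andP[/negbTE -> /negbTE ->].
  by rewrite !mulr0 addr0.
have uw : dotv u w = 0 by exact: dotv_restr_disjoint.
have /andP[_] := rip (l2norm w) (l2norm u).
have /andP[+ _] := rip (l2norm w) (- l2norm u).
rewrite !l2norm_comb_sqr uw; lra.
Qed.

(** The term with d has the shape of the off-diagonal bound, so that in [rip_sum_blocks] the double
    sum becomes a full square. *)
Lemma rip_dotv_self S v : (#|S| <= k)%N ->
  dotv (A *m restr_vec S v) (A *m restr_vec S v) <=
  l2norm (restr_vec S v) ^+ 2 + d * (l2norm (restr_vec S v) * l2norm (restr_vec S v)).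
Proof.
move=> Sk; rewrite -l2norm_dotv.
have [|_ h] := ripA (z := restr_vec S v).
  apply: (@sparse_supp _ _ S) => [|i /negbTE iS]; last by rewrite mxE iS.
  by rewrite mul2n -addnn (leq_trans Sk)// leq_addr.
by apply: le_trans h _; lra.
Qed.

Lemma rip_sum_blocks (B : nat -> {set 'I_n}) l v :
  (forall j, (j < l)%N -> (#|B j| <= k)%N) ->
  (forall i j, (i < j)%N -> [disjoint B i & B j]) ->
  l2norm (A *m (\sum_(j < l) restr_vec (B j) v)) ^+ 2 <=
  \sum_(j < l) l2norm (restr_vec (B j) v) ^+ 2 +
  d * (\sum_(j < l) l2norm (restr_vec (B j) v)) ^+ 2.
Proof.
move=> Bk Bd; rewrite l2norm_dotv mulmx_sumr dotv_suml.
under eq_bigr do rewrite dotvC dotv_suml.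
rewrite expr2 mulr_suml mulr_sumr -big_split/=.
apply: ler_sum => i _; rewrite mulr_sumr mulr_sumr.
(* The diagonal contribution is spread over j, so that the double sums compare term by term. *)
rewrite [X in X + _](_ : _ = \sum_(j < l)
   if j == i then l2norm (restr_vec (B i) v) ^+ 2 else 0); last first.
  by rewrite -big_mkcond/= big_pred1_eq.
rewrite -big_split/=; apply: ler_sum => j _.
case: eqVneq => [->|ji].
  by apply: rip_dotv_self; exact: Bk.
rewrite add0r dotvC; apply: rip_dotv_disjoint; rewrite ?Bk//.
move: ji; rewrite -val_eqE neq_ltn => /orP[/Bd|/Bd//].
by rewrite disjoint_sym.
Qed.

End Rip.
End Vectors.

(** * From the isometry bounds to the recovery estimate *)

Section Estimates.
Variable R : realType.
Local Set Implicit Arguments. Local Unset Strict Implicit.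

Lemma ler_of_sqr (x y : R) : 0 <= x -> 0 <= y -> x ^+ 2 <= y ^+ 2 -> x <= y.
Proof. by move=> x0 y0; rewrite ler_pXn2r// nnegrE. Qed.

(** [V <= 2 * c] is applied only to the cross term 2 a sqrt(V), which becomes 2 sqrt(2) a sqrt(c);
    the sharper bound by c absorbs V itself. *)
Lemma head_norm_le (d a N0 N1 V c : R) : d < 1 -> 0 <= a -> 0 <= N0 -> 0 <= V ->
  (1 - d) * (N0 ^+ 2 + N1 ^+ 2) <= (a + Num.sqrt V) ^+ 2 ->
  V - (1 - d) * N1 ^+ 2 <= c -> V <= 2 * c ->
  Num.sqrt (1 - d) * N0 <= Num.sqrt 2 * a + Num.sqrt c.
Proof.
move=> d1 a0 N00 V0 h Vc V2c.
have c0 : 0 <= c by lra.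
apply: ler_of_sqr; rewrite ?addr_ge0 ?mulr_ge0 ?sqrtr_ge0//.
have vs : Num.sqrt V <= Num.sqrt 2 * Num.sqrt c by rewrite -sqrtrM// ler_wsqrtr.
have av := ler_wpM2l a0 vs.
have sV := sqr_sqrtr V0; have sc := sqr_sqrtr c0.
have s2 : Num.sqrt 2 ^+ 2 = 2 :> R by rewrite sqr_sqrtr.
have sd : Num.sqrt (1 - d) ^+ 2 = 1 - d by rewrite sqr_sqrtr// subr_ge0 ltW.
rewrite exprMn sd [leRHS]sqrrD exprMn s2 sc.
move: h; rewrite [leRHS]sqrrD sV; have := sqr_ge0 a; lra.
Qed.

Lemma total_norm_le (d a N V X c : R) : d < 1 -> 0 <= a -> 0 <= X -> 0 <= V ->
  0 <= N ->
  (1 - d) * (N ^+ 2 - X) <= (a + Num.sqrt V) ^+ 2 ->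
  V + (1 - d) * X <= c ->
  Num.sqrt (1 - d) * N <= a + Num.sqrt c.
Proof.
move=> d1 a0 X0 V0 N0 h Vc.
have dX : 0 <= (1 - d) * X by rewrite mulr_ge0// subr_ge0 ltW.
have c0 : 0 <= c by lra.
apply: ler_of_sqr; rewrite ?addr_ge0 ?mulr_ge0 ?sqrtr_ge0//.
have vs : Num.sqrt V <= Num.sqrt c by rewrite ler_wsqrtr//; lra.
have av := ler_wpM2l a0 vs.
have sV := sqr_sqrtr V0; have sc := sqr_sqrtr c0.
have sd : Num.sqrt (1 - d) ^+ 2 = 1 - d by rewrite sqr_sqrtr// subr_ge0 ltW.
rewrite exprMn sd [leRHS]sqrrD sc.
move: h; rewrite [leRHS]sqrrD sV; lra.
Qed.

Lemma sqrt_powR (x p : R) : 0 <= x -> Num.sqrt x `^ p = x `^ (p / 2).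
Proof. by move=> x0; rewrite -powR12_sqrt// -powRrM mulrC. Qed.

Lemma powR_norm_le (d N u c p : R) : d < 1 -> 0 < p < 1 ->
  0 <= N -> 0 <= u -> 0 <= c ->
  Num.sqrt (1 - d) * N <= u + Num.sqrt c ->
  N `^ p <= u `^ p / (1 - d) `^ (p / 2) + (c / (1 - d)) `^ (p / 2).
Proof.
move=> d1 /andP[p0 p1] N0 u0 c0 h.
have d0 : 0 < 1 - d by rewrite subr_gt0.
rewrite powRM ?invr_ge0 ?(ltW d0)// -(powR_inv1 (ltW d0)) -powRrM mulN1r powRN.
rewrite -mulrDl ler_pdivlMr ?powR_gt0// mulrC -sqrt_powR ?(ltW d0)//.
rewrite -powRM ?sqrtr_ge0// -(sqrt_powR _ c0).
apply: le_trans (_ : (u + Num.sqrt c) `^ p <= _).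
  by rewrite ler_powRl ?mulr_ge0 ?sqrtr_ge0 ?(ltW p0).
by apply: powRD_le; rewrite ?sqrtr_ge0// p0 ltW.
Qed.

Lemma sqr_powR_norm (x p : R) : 0 < p -> x ^+ 2 = (`|x| `^ p) `^ (2 / p).
Proof.
move=> p0; rewrite -powRrM mulrCA divff ?gt_eqF// mulr1 powR_mulrn//.
by rewrite real_normK// num_real.
Qed.

(** Hölder's inequality through a tangent: with q the mean of the squares over T, the map t^(p/2) is
    bounded by its tangent at t = 1 for t = v_i^2 / q, and the linear terms cancel in the sum. *)
Lemma sum_powR_le_l2norm n (T : {set 'I_n}) (v : 'cV[R]_n) (p : R) :
  0 < p < 1 -> (0 < #|T|)%N ->
  \sum_(i in T) `|v i ord0| `^ p <=
  #|T|%:R `^ (1 - p / 2) * l2norm (restr_vec T v) `^ p.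
Proof.
move=> /andP[p0 p1] T0; have kR : 0 < #|T|%:R :> R by rewrite ltr0n.
set N := l2norm _; have N0 : 0 <= N by exact: l2norm_ge0.
have N2 : N ^+ 2 = \sum_(i in T) v i ord0 ^+ 2 by exact: l2norm_restr_sqr.
have [Nz|Nn0] := eqVneq N 0.
  rewrite big1 ?mulr_ge0 ?powR_ge0// => i iT.
  have /esym/psumr_eq0P : 0 = \sum_(i in T) v i ord0 ^+ 2 by rewrite -N2 Nz expr0n.
  move=> /(_ (fun i _ => sqr_ge0 _)) /(_ i iT) /eqP; rewrite sqrf_eq0 => /eqP->.
  by rewrite normr0 powR0 ?gt_eqF.
have {Nn0}N0 : 0 < N by rewrite lt_neqAle eq_sym Nn0.
pose q := N ^+ 2 / #|T|%:R.
have q0 : 0 < q by rewrite divr_gt0// exprn_gt0.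
have step i : `|v i ord0| `^ p <= q `^ (p / 2) * (1 + p / 2 * (v i ord0 ^+ 2 / q - 1)).
  have := @powR_le_tangent R (v i ord0 ^+ 2 / q) (p / 2).
  rewrite divr_ge0 ?sqr_ge0 ?(ltW q0)// => /(_ isT) h.
  rewrite -[leLHS](_ : q `^ (p / 2) * (v i ord0 ^+ 2 / q) `^ (p / 2) = _).
    by rewrite ler_wpM2l ?powR_ge0// h//; lra.
  rewrite -powRM ?divr_ge0 ?sqr_ge0 ?(ltW q0)// mulrC divfK ?gt_eqF//.
  by rewrite -real_normK ?num_real// -powR_mulrn// -powRrM; congr (_ `^ _); field.
apply: le_trans (ler_sum _ (fun i _ => step i)) _.
rewrite -mulr_sumr big_split/= sumr_const -mulr_sumr sumrB sumr_const -mulr_suml -N2.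
have -> : N ^+ 2 / q = #|T|%:R by rewrite /q; field; rewrite !gt_eqF.
rewrite subrr mulr0 addr0 /q powRM ?sqr_ge0 ?invr_ge0 ?ler0n//.
rewrite -(powR_inv1 (ltW kR)) -powRrM mulN1r -powR_mulrn ?(ltW N0)// -powRrM.
have -> : 2%:R * (p / 2) = p by field.
rewrite (@powRD _ _ 1) ?powRr1 ?(ltW kR)//; last by rewrite (gt_eqF kR) implybT.
by rewrite le_eqVlt; apply/predU1P; left; ring.
Qed.

Lemma lpnorm_powR n (v : 'cV[R]_n) (p : R) : 0 < p ->
  lpnorm p v `^ p = \sum_(i < n) `|v i ord0| `^ p.
Proof.
move=> p0; rewrite /lpnorm -powRrM divfK ?gt_eqF// powRr1//.
by rewrite sumr_ge0// => i _; rewrite powR_ge0.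
Qed.

Lemma lpnorm_restr_powR n (T : {set 'I_n}) (v : 'cV[R]_n) (p : R) : 0 < p ->
  lpnorm p (restr_vec T v) `^ p = \sum_(i in T) `|v i ord0| `^ p.
Proof.
move=> p0; rewrite lpnorm_powR// [RHS]big_mkcond; apply: eq_bigr => i _.
by rewrite mxE; case: ifP => // _; rewrite normr0 powR0 ?gt_eqF.
Qed.

(** With h = x - z, |x_i|^p <= |z_i|^p + |h_i|^p is summed on T and |h_i|^p <= |x_i|^p + |z_i|^p off
    T; the comparison of the norms of z and x removes z. *)
Lemma cone_ineq n (T : {set 'I_n}) (x z : 'cV[R]_n) (p : R) : 0 < p < 1 ->
  lpnorm p z <= lpnorm p x ->
  \sum_(i in ~: T) `|(x - z) i ord0| `^ p <=
  \sum_(i in T) `|(x - z) i ord0| `^ p + 2 * \sum_(i in ~: T) `|x i ord0| `^ p.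
Proof.
move=> /andP[p0 p1] zx.
have tri (s t : R) : `|s + t| `^ p <= `|s| `^ p + `|t| `^ p.
  apply: le_trans (@powRD_le R _ _ p (normr_ge0 s) (normr_ge0 t) _); last first.
    by rewrite p0 ltW.
  by rewrite ler_powRl ?(ltW p0)// ler_normD.
have : \sum_i `|z i ord0| `^ p <= \sum_i `|x i ord0| `^ p.
  rewrite -(lpnorm_powR z p0) -(lpnorm_powR x p0).
  exact: ler_powRl (ltW p0) (powR_ge0 _ _) zx.
clear zx; rewrite (bigID (mem T)) [leRHS](bigID (mem T))/=.
have cE (f : 'I_n -> R) : \sum_(i in ~: T) f i = \sum_(i | i \notin T) f i.
  by apply: eq_bigl => i; rewrite inE.
rewrite !cE => zx'.
have hT : \sum_(i in T) `|x i ord0| `^ p <=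
    \sum_(i in T) `|z i ord0| `^ p + \sum_(i in T) `|(x - z) i ord0| `^ p.
  rewrite -big_split ler_sum// => i _; rewrite !mxE.
  by rewrite -{1}(subrKC (z i ord0) (x i ord0)) tri.
have hC : \sum_(i | i \notin T) `|(x - z) i ord0| `^ p <=
    \sum_(i | i \notin T) `|x i ord0| `^ p + \sum_(i | i \notin T) `|z i ord0| `^ p.
  rewrite -big_split ler_sum// => i _; rewrite !mxE.
  by apply: le_trans (tri _ _) _; rewrite normrN.
lra.
Qed.

(** As a sum over T, a restriction can be split along the blocks by the summation identity. *)
Lemma restr_vec_delta n (T : {set 'I_n}) (v : 'cV[R]_n) :
  restr_vec T v = \sum_(i in T) v i ord0 *: delta_mx i ord0.
Proof.
apply/colP => j; rewrite mxE summxE big_mkcond (bigD1 j)//= !mxE !eqxx mulr1.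
rewrite big1 ?addr0// => i ij; rewrite !mxE eq_sym (negbTE ij) mulr0.
by case: ifP.
Qed.

Lemma restr_vecU n (S T : {set 'I_n}) (v : 'cV[R]_n) : [disjoint S & T] ->
  restr_vec (S :|: T) v = restr_vec S v + restr_vec T v.
Proof.
move=> dST; apply/colP => i; rewrite !mxE inE.
case: (boolP (i \in S)) => [iS|_]; last by rewrite add0r.
by rewrite (disjointFr dST iS) addr0.
Qed.

(* [mu] stands for the maximum of [gfun p] and [2 `^ (1 - 2 / p)].  The factor
   [Num.sqrt 2] appears because [2^-1 <= d] makes the bound of [X + d * Y] at
   most twice the radicand of the first estimate. *)
Lemma rip_norm_le m n k l (A : 'M[R]_(m, n)) (d mu p : R) (T : {set 'I_n})
    (h : 'cV[R]_n) :
  (0 < k)%N -> (0 < l)%N -> RIP_bound (2 * k) A d -> 2^-1 <= d < 1 -> 0 < p < 1 ->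
  gfun p <= mu -> 2 `^ (1 - 2 / p) <= mu -> #|T| = k -> #|~: T| = (l * k)%N ->
  let K := k%:R `^ (1 - 2 / p) * (\sum_(i in ~: T) `|h i ord0| `^ p) `^ (2 / p) in
  Num.sqrt (1 - d) * l2norm (restr_vec T h) <= Num.sqrt 2 * l2norm (A *m h) +
    Num.sqrt (((2 - d) `^ (1 - 2 / p) * gfun p + 2 * d * mu) * K) /\
  Num.sqrt (1 - d) * l2norm h <= l2norm (A *m h) +
    Num.sqrt (((2 - d) * gfun p + 2 * d * mu) * K).
Proof.
(* From here [l] counts the blocks after [B 0], which is joined to [T]. *)
move=> k0; case: l => // l _ ripA /andP[d2 d1] p01 gmu twomu Tk Tck.
have [p0 p1] := andP p01.
pose b i := `|h i ord0| `^ p; have b0 i : 0 <= b i by exact: powR_ge0.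
have bE i : h i ord0 ^+ 2 = b i `^ (2 / p) by exact: sqr_powR_norm.
have [B [BT Bk Bd Bmax Bsum]] := @decreasing_blocks R _ b _ _ _ Tck.
set S := \sum_(i in ~: T) _ => K.
have S0 : 0 <= S by exact: sumr_ge0.
have K0 : 0 <= K by rewrite mulr_ge0 ?powR_ge0.
have normE j : l2norm (restr_vec (B j) h) ^+ 2 = \sum_(i in B j) b i `^ (2 / p).
  by rewrite l2norm_restr_sqr; apply: eq_bigr => i _; rewrite bE.
have SE : S = \sum_(j < l.+1) \sum_(i in B j) b i by exact: Bsum.
pose rest := \sum_(j < l) restr_vec (B j.+1) h.
pose X := \sum_(j < l) l2norm (restr_vec (B j.+1) h) ^+ 2.
pose Y := (\sum_(j < l) l2norm (restr_vec (B j.+1) h)) ^+ 2.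
have X0 : 0 <= X by rewrite sumr_ge0// => j _; rewrite sqr_ge0.
have Y0 : 0 <= Y by rewrite sqr_ge0.
have g0 : 0 <= gfun p by exact: gfun_ge0.
have mu0 : 0 <= mu by exact: le_trans gmu.
have TB0 : [disjoint T & B 0%N].
  by rewrite disjoint_sym finset.disjoints_subset.
have hE : h = restr_vec (T :|: B 0%N) h + rest.
  rewrite restr_vecU// -addrA -[X in _ + X](_ : restr_vec (~: T) h = _).
    by apply/colP => i; rewrite !mxE inE; case: ifP; rewrite ?addr0 ?add0r.
  rewrite restr_vec_delta Bsum big_ord_recl; congr (_ + _).
    by rewrite restr_vec_delta.
  by apply: eq_bigr => j _; rewrite restr_vec_delta.
have headE : l2norm (restr_vec (T :|: B 0%N) h) ^+ 2 =
    l2norm (restr_vec T h) ^+ 2 + l2norm (restr_vec (B 0%N) h) ^+ 2.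
  rewrite restr_vecU// -{1}[restr_vec T h]scale1r -{1}[restr_vec (B _) h]scale1r.
  by rewrite l2norm_comb_sqr dotv_restr_disjoint//; ring.
have totalE : l2norm h ^+ 2 = l2norm (restr_vec T h) ^+ 2 +
    l2norm (restr_vec (B 0%N) h) ^+ 2 + X.
  have -> : l2norm h ^+ 2 = \sum_(i in T) h i ord0 ^+ 2 + \sum_(i in ~: T) h i ord0 ^+ 2.
    rewrite l2norm_sqr (bigID (mem T))/=; congr (_ + _).
    by apply: eq_bigl => i; rewrite inE.
  rewrite Bsum big_ord_recl -!l2norm_restr_sqr addrA; congr (_ + _).
  by apply: eq_bigr => j _; rewrite l2norm_restr_sqr.
have rest_le : l2norm (A *m rest) <= Num.sqrt (X + d * Y).
  rewrite -[leLHS]ger0_norm ?l2norm_ge0// -sqrtr_sqr ler_wsqrtr//.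
  apply: (@rip_sum_blocks _ _ _ _ _ _ ripA (fun j => B j.+1)) => [j jl|i j ij].
    by rewrite Bk.
  exact: Bd.
have V0 : 0 <= X + d * Y by rewrite addr_ge0// mulr_ge0//; lra.
have main : (1 - d) * (l2norm (restr_vec T h) ^+ 2 +
    l2norm (restr_vec (B 0%N) h) ^+ 2) <=
    (l2norm (A *m h) + Num.sqrt (X + d * Y)) ^+ 2.
  rewrite -headE; have [|lo _] := ripA (restr_vec (T :|: B 0%N) h).
    apply: (@sparse_supp _ _ _ (T :|: B 0%N)) => [|i /negbTE iT].
      by rewrite mul2n -addnn (leq_trans (leq_card_setU _ _))// Tk Bk.
    by rewrite mxE iT.
  apply: le_trans lo _; rewrite ler_pXn2r ?nnegrE ?addr_ge0 ?sqrtr_ge0//.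
  have -> : A *m restr_vec (T :|: B 0%N) h = A *m h + - (A *m rest).
    by rewrite {2}hE mulmxDr addrK.
  by apply: le_trans (ler_l2normD _ _) _; rewrite l2normN lerD2l.
have cover i : i \in ~: T :\: B 0%N -> exists2 j, (j < l)%N & i \in B j.+1.
  rewrite inE => /andP[iB iT].
  have [[[|j] jl] ij] : exists j : 'I_l.+1, i \in B j.
    apply/existsP; apply: contraT => /existsPn nB.
    (* If no block contained i, the indicator of i would have sum 1 over the complement of T but sum
       0 over the blocks. *)
    have := Bsum R (fun x => (x == i)%:R).
    rewrite (bigD1 i)//= eqxx big1 => [|x /andP[_ /negbTE->]//].
    rewrite big1 => [/eqP|j _]; first by rewrite addr0 oner_eq0.
    by rewrite big1// => x xB; case: eqVneq xB (nB j) => // -> ->.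
  - by rewrite ij in iB.
  - by exists j.
have tailE (f : 'I_n -> R) : \sum_(i in ~: T :\: B 0%N) f i =
    \sum_(j < l) \sum_(i in B j.+1) f i.
  have := Bsum R f; rewrite big_ord_recl (big_setID (B 0%N))/=.
  by rewrite (finset.setIidPr (BT 0%N)) => /addrI.
have tail t : 0 <= t -> X - t * l2norm (restr_vec (B 0%N) h) ^+ 2 <=
    (1 + t) `^ (1 - 2 / p) * gfun p * K.
  move=> t0.
  have := @tail_sum_le R _ b (B 0%N) (~: T :\: B 0%N) p t.
  rewrite Bk// p0 t0 k0 tailE normE => /(_ _ isT isT b0).
  have -> : \sum_(j < l) \sum_(i in B j.+1) b i `^ (2 / p) = X.
    by apply: eq_bigr => j _; rewrite normE.
  have -> : \sum_(i in B 0%N) b i + \sum_(i in ~: T :\: B 0%N) b i = S.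
    by rewrite tailE SE big_ord_recl.
  move=> le; apply: le_trans (le _ _) _.
  - lra.
  - by move=> i i' iB /cover[j _ i'B]; apply: Bmax iB i'B.
  rewrite powRM ?ler0n//; last by rewrite addr_ge0.
  by rewrite le_eqVlt; apply/predU1P; left; rewrite /K; ring.
have X_le : X <= gfun p * K.
  by have := tail 0 (lexx _); rewrite mul0r subr0 addr0 powR1 mul1r.
have Y_le : Y <= 2 * mu * K.
  (* The least c allowed by both conditions in terms of [mu], since the square of 2^(1-1/p) is 2 *
     2^(1-2/p). *)
  pose c : R := Num.sqrt (2 * mu).
  have cE : c ^+ 2 = 2 * mu by rewrite sqr_sqrtr// mulr_ge0.
  have -> : Y = (\sum_(j < l) Num.sqrt (\sum_(x in B j.+1) b x `^ (2 / p))) ^+ 2.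
    congr (_ ^+ 2); apply: eq_bigr => j _.
    by rewrite -normE sqrtr_sqr ger0_norm ?l2norm_ge0.
  rewrite -cE /K SE; apply: sum_block_norms_le => //.
  - exact: sqrtr_ge0.
  - by rewrite cE; lra.
  apply: ler_of_sqr; rewrite ?powR_ge0 ?sqrtr_ge0// cE.
  rewrite -powR_mulrn ?powR_ge0// -powRrM.
  have -> : (1 - 1 / p) * 2%:R = 1 + (1 - 2 / p) by field; rewrite gt_eqF.
  by rewrite powRD ?powRr1 ?pnatr_eq0 ?implybT//; lra.
have gK0 : 0 <= gfun p * K by rewrite mulr_ge0.
have gmuK : gfun p * K <= mu * K by rewrite ler_wpM2r.
(* The lower bound on d enters here: 1 <= 2 d gives X + d Y <= 4 d mu K, twice the term 2 d mu K of
   the first radicand. *)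
have dmuK : mu * K <= 2 * d * (mu * K).
  by apply: ler_peMl; [exact: mulr_ge0|lra].
have dY : d * Y <= d * (2 * mu * K) by rewrite ler_wpM2l//; lra.
have gK2 : 0 <= (2 - d) `^ (1 - 2 / p) * gfun p * K.
  by do 2?apply: mulr_ge0; rewrite ?powR_ge0.
have d10 : 0 <= 1 - d by rewrite subr_ge0 ltW.
split.
  apply: (head_norm_le (N1 := l2norm (restr_vec (B 0%N) h)) d1 _ _ V0) main _ _;
    rewrite ?l2norm_ge0//.
    have := tail (1 - d) d10; have -> : 1 + (1 - d) = 2 - d by ring.
    by lra.
  by lra.
apply: (total_norm_le (X := X) d1 _ X0 V0); rewrite ?l2norm_ge0//.
  by rewrite totalE addrK.
(* X and (1 - d) X combine into (2 - d) X, the source of the factor 2 - d. *)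
have := ler_wpM2l d10 X_le; lra.
Qed.

(** Put w = k^(p/2-1) |h_(T^c)|_p^p, so that K^(p/2) = w. The cone and Hölder inequalities bound w
    by |h_T|_2^p plus a multiple of the tail of x, and the first norm estimate bounds |h_T|_2^p by a
    noise term plus C w. As C < 1 this can be solved for w, and the second estimate turns w into a
    bound for h. *)
Lemma rip_recovery m n k l (A : 'M[R]_(m, n)) (d mu p : R) (T : {set 'I_n})
    (x z : 'cV[R]_n) (eps : R) :
  (0 < k)%N -> (0 < l)%N -> RIP_bound (2 * k) A d -> 2^-1 <= d < 1 -> 0 < p < 1 ->
  gfun p <= mu -> 2 `^ (1 - 2 / p) <= mu -> #|T| = k -> #|~: T| = (l * k)%N ->
  0 <= eps -> lpnorm p z <= lpnorm p x -> l2norm (A *m (x - z)) <= 2 * eps ->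
  let C := (((2 - d) `^ (1 - 2 / p) * gfun p + 2 * d * mu) / (1 - d)) `^ (p / 2) in
  let D := (((2 - d) * gfun p + 2 * d * mu) / (1 - d)) `^ (p / 2) in
  C < 1 ->
  l2norm (x - z) `^ p <=
    2 * D / (1 - C) * k%:R `^ (p / 2 - 1) * lpnorm p (restr_vec (~: T) x) `^ p +
    1 / (1 - d) `^ (p / 2) * (2 `^ p + 2 `^ (3 * p / 2) * D / (1 - C)) * eps `^ p.
Proof.
move=> k0 l0 ripA d12 p01 gmu twomu Tk Tck eps0 zx Aeps C D C1.
have [p0 p1] := andP p01; have [d2 d1] := andP d12.
have kR : 0 < k%:R :> R by rewrite ltr0n.
have cone := cone_ineq T p01 zx; clear zx.
set h := x - z in Aeps cone *.
have [] := @rip_norm_le m n k l A d mu p T h k0 l0 ripA d12 p01 gmu twomu Tk Tck.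
set S := \sum_(i in ~: T) _; set K := _ * S `^ _.
set c1 := _ + 2 * d * mu; set c2 := (2 - d) * _ + _ => hT hN.
have S0 : 0 <= S by rewrite sumr_ge0// => i _; rewrite powR_ge0.
have K0 : 0 <= K by rewrite mulr_ge0 ?powR_ge0.
have g0 : 0 <= gfun p by exact: gfun_ge0.
have mu0 : 0 <= mu by exact: le_trans gmu.
have dmu0 : 0 <= 2 * d * mu by rewrite mulr_ge0//; lra.
have c10 : 0 <= c1 by rewrite addr_ge0// mulr_ge0 ?powR_ge0.
have c20 : 0 <= c2 by rewrite addr_ge0// mulr_ge0//; lra.
have d0 : 0 < 1 - d by rewrite subr_gt0.
set w := k%:R `^ (p / 2 - 1) * S.
have Kw c : 0 <= c -> (c * K / (1 - d)) `^ (p / 2) = (c / (1 - d)) `^ (p / 2) * w.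
  move=> c0; rewrite mulrAC powRM ?divr_ge0 ?(ltW d0)//; congr (_ * _).
  rewrite powRM ?powR_ge0// -!powRrM.
  have -> : 2 / p * (p / 2) = 1 by field; rewrite gt_eqF.
  by rewrite powRr1//; congr (_ `^ _ * _); field; rewrite gt_eqF.
set a := l2norm (A *m h) in hT hN Aeps.
have a0 : 0 <= a by exact: l2norm_ge0.
have hTp := powR_norm_le d1 p01 (l2norm_ge0 _) (mulr_ge0 (sqrtr_ge0 2) a0)
  (mulr_ge0 c10 K0) hT.
have hNp := powR_norm_le d1 p01 (l2norm_ge0 _) a0 (mulr_ge0 c20 K0) hN.
rewrite Kw// -/C powRM ?sqrtr_ge0// sqrt_powR// in hTp.
rewrite Kw// -/D in hNp.
rewrite -/S in cone.
rewrite lpnorm_restr_powR//.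
set sig := \sum_(i in ~: T) `|x i ord0| `^ p in cone *.
have sig0 : 0 <= sig by rewrite sumr_ge0// => i _; rewrite powR_ge0.
have hold : \sum_(i in T) `|h i ord0| `^ p <= k%:R `^ (1 - p / 2) *
    l2norm (restr_vec T h) `^ p.
  by rewrite -Tk; apply: sum_powR_le_l2norm; rewrite ?Tk.
set kap := k%:R `^ (p / 2 - 1) in w Kw hTp hNp *.
(* The weight in w is the inverse of the Hölder factor. *)
have kapE : kap * k%:R `^ (1 - p / 2) = 1.
  rewrite -powRD; last by rewrite (gt_eqF kR) implybT.
  by rewrite -[RHS](powRr0 k%:R); congr (_ `^ _); ring.
have kap0 : 0 <= kap by exact: powR_ge0.
have w_le : w <= l2norm (restr_vec T h) `^ p + 2 * (kap * sig).
  have := ler_wpM2l kap0 (le_trans cone (lerD hold (lexx _))).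
  by rewrite mulrDr [X in X + _]mulrA kapE mul1r mulrCA.
have aeps : a `^ p <= 2 `^ p * eps `^ p.
  by rewrite -powRM// ler_powRl ?(ltW p0).
(* One factor stems from the sqrt(2) of the first estimate, the other from |Ah|_2 <= 2 eps. *)
have E23 : 2 `^ (3 * p / 2) = 2 `^ (p / 2) * 2 `^ p :> R.
  rewrite -powRD; last by rewrite pnatr_eq0 implybT.
  by congr (_ `^ _); field.
rewrite E23.
set del := (1 - d) `^ (p / 2) in hTp hNp *.
have del0 : 0 < del by rewrite powR_gt0.
have C1' : 0 < 1 - C by rewrite subr_gt0.
have D0 : 0 <= D by exact: powR_ge0.
set E2 := 2 `^ (p / 2) in hTp *.
have E20 : 0 <= E2 by exact: powR_ge0.
set F := 2 `^ p * eps `^ p in aeps.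
have adel : a `^ p / del <= F / del by rewrite ler_pM2r ?invr_gt0.
have w_le' : w <= (E2 * (F / del) + 2 * (kap * sig)) / (1 - C).
  rewrite ler_pdivlMr//; have := ler_wpM2l E20 adel; lra.
have Dw := ler_wpM2l D0 w_le'.
apply: le_trans hNp _; apply: le_trans (lerD adel Dw) _.
rewrite le_eqVlt; apply/predU1P; left; rewrite /F; field.
by rewrite !gt_eqF.
Qed.

End Estimates.

(** * Choice of the index set and conclusion *)

Lemma card_ord_lt (n k : nat) : (k <= n)%N -> #|[set i : 'I_n | (i < k)%N]| = k.
Proof.
move=> kn; rewrite -sum1_card (eq_bigl (fun i : 'I_n => (i < k)%N)).
  by rewrite -(big_ord_widen _ (fun=> 1%N) kn) sum1_card card_ord.
by move=> i; rewrite inE.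
Qed.

(** The missing elements are taken from the complement by [top_subset] with a constant function, for
    which any choice is maximal. *)
Lemma subset_card_extend (I : finType) (S : {set I}) (k : nat) :
  (#|S| <= k <= #|I|)%N -> exists2 T : {set I}, S \subset T & #|T| = k.
Proof.
move=> /andP[Sk kI]; have [|B [BS Bk _]] :=
    @top_subset _ nat I (fun=> 0%N) (~: S) (k - #|S|).
  by rewrite leq_subLR cardsC.
exists (S :|: B); first exact: finset.subsetUl.
rewrite cardsU Bk; move: BS; rewrite -finset.disjoints_subset disjoint_sym.
by rewrite -setI_eq0 => /eqP->; rewrite cards0 subn0 subnKC.
Qed.

Theorem theorem2 (R : realType) (k l m n : nat) (hk : (0 < k)%N) (hl : (0 < l)%N)
  (hm : (0 < m)%N) (hn : n = (l.+1 * k)%N)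
  (A : 'M[R]_(m, n)) (d : R) (hd : is_RIC (2 * k) A d)
  (hd1 : Num.sqrt 2 / 2 <= d) (hd2 : d < 1)
  (ps : R) (hps : is_pstar ps)
  (x : 'cV[R]_n) (eps : R) (heps : 0 <= eps) (e : 'cV[R]_m) (he : l2norm e <= eps)
  (y : 'cV[R]_m) (hy : y = A *m x + e)
  (p : R) (hp0 : 0 < p) (hp1 : p < 1)
  (xs : 'cV[R]_n) (hxs : lp_minimizer p eps A y xs)
  (hC : Cfun ps d p < 1) :
  let T0c := [set i : 'I_n | (k <= i)%N] in
  let D0 := 2 * Dfun ps d p / (1 - Cfun ps d p) in
  let D1 := 1 / (1 - d) `^ (p / 2) *
            (2 `^ p + 2 `^ (3 * p / 2) * Dfun ps d p / (1 - Cfun ps d p)) in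
  (l2norm (x - xs)) `^ p <=
    D0 * (k%:R) `^ (p / 2 - 1) * (lpnorm p (restr_vec T0c x)) `^ p + D1 * eps `^ p
  /\ (eps = 0 -> sparse k x -> xs = x).
Proof.
move=> T0c D0 D1.
have d2 : 2^-1 <= d.
  apply: le_trans hd1; have : 1 <= Num.sqrt 2 :> R by rewrite -{1}sqrtr1 ler_sqrt ?ler1n.
  by lra.
have d12 : 2^-1 <= d < 1 by rewrite d2.
have p01 : 0 < p < 1 by rewrite hp0.
(* On either side of [ps] this is the larger of the two values, and it merges the two cases of
   [Cfun] and of [Dfun] into one formula. *)
pose mu : R := if p <= ps then gfun p else 2 `^ (1 - 2 / p).
have gmu : gfun p <= mu.
  rewrite /mu; have [//|psp] := leP p ps; apply: (@gfun_le_pstar _ _ _ hps).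
  by rewrite !ltW.
have twomu : 2 `^ (1 - 2 / p) <= mu.
  rewrite /mu; have [pps|//] := leP p ps; apply: (@gfun_ge_pstar _ _ _ hps).
  by rewrite hp0.
have two2 : 2 `^ (2 - 2 / p) = 2 * 2 `^ (1 - 2 / p) :> R.
  have -> : 2 - 2 / p = 1 + (1 - 2 / p) by ring.
  by rewrite powRD ?powRr1 ?pnatr_eq0 ?implybT.
have CE : Cfun ps d p =
    (((2 - d) `^ (1 - 2 / p) * gfun p + 2 * d * mu) / (1 - d)) `^ (p / 2).
  rewrite /Cfun /mu; case: ifP => _; congr ((_ / _) `^ _); first by ring.
  by rewrite two2; ring.
have DE : Dfun ps d p =
    (((2 - d) * gfun p + 2 * d * mu) / (1 - d)) `^ (p / 2).
  rewrite /Dfun /mu; case: ifP => _; congr ((_ / _) `^ _); first by ring.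
  by rewrite two2; ring.
have [feas opt] := hxs.
have lexsx : lpnorm p xs <= lpnorm p x.
  (* x is feasible, its residual being e. *)
  by apply: opt; rewrite hy addrC addKr.
have Aeps : l2norm (A *m (x - xs)) <= 2 * eps.
  have -> : A *m (x - xs) = (y - A *m xs) + - e.
    by rewrite hy mulmxBr addrAC addrK.
  apply: le_trans (ler_l2normD _ _) _; rewrite l2normN.
  by have := lerD feas he; lra.
have kn : (k <= n)%N by rewrite hn mulSn leq_addr.
have recover (T : {set 'I_n}) : #|T| = k -> l2norm (x - xs) `^ p <=
    D0 * k%:R `^ (p / 2 - 1) * lpnorm p (restr_vec (~: T) x) `^ p + D1 * eps `^ p.
  move=> Tk; have Tck : #|~: T| = (l * k)%N.
    by rewrite cardsCs finset.setCK Tk card_ord hn mulSn addKn.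
  rewrite /D0 /D1 CE DE.
  apply: (rip_recovery _ hl (proj1 hd)) => //.
  by rewrite -CE.
split.
  have -> : T0c = ~: [set i : 'I_n | (i < k)%N].
    by apply/setP => i; rewrite !inE -leqNgt.
  exact: recover (card_ord_lt _ _ kn).
move=> eps0 xsparse.
have [|T xT Tk] := @subset_card_extend _ [set i | x i ord0 != 0] k.
  by rewrite card_ord kn andbT.
have := recover T Tk; rewrite eps0 (powR0 (lt0r_neq0 hp0)) mulr0 addr0.
(* T contains the support of x, so the tail term vanishes together with the noise term. *)
rewrite lpnorm_restr_powR// big1 ?mulr0 => [h0|i]; last first.
  rewrite inE; apply: contraNeq => xi; apply: (fintype.subsetP xT).
  by rewrite inE; apply: contraNneq xi => ->; rewrite normr0 powR0 ?lt0r_neq0.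
apply/eqP; rewrite eq_sym -subr_eq0; apply/eqP; apply: l2norm_eq0.
by apply: (@powR_eq0_eq0 _ _ p); apply/eqP; rewrite eq_le h0 powR_ge0.
Qed.
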